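(* Let $R$ be a ring with $1\neq 0$ (not necessarily commutative), let $n\geq 2$, and let $a_1,\dots,a_n$ be elements of the center of $R$ with $Ra_1+\cdots+Ra_n=R$. Let $S=\{(x_1,\dots,x_n)\in R^n : a_1x_1+\cdots+a_nx_n=0\}$, and let $M\subseteq\{1,\dots,n\}$ be a subset with $\sum_{i\in M}Ra_i=R$. Suppose that $M$ is normal. Then $\ker\Lambda=Y$; that is, the relations $a_kv(i,j)-a_jv(i,k)+a_iv(j,k)=0$, $(i,j,k)\in E$, are defining relations for $S$ with respect to the generators $v(i,j)$, $(i,j)\in D$: $$S\cong\langle x(i,j),\ (i,j)\in D \mid a_kx(i,j)-a_jx(i,k)+a_ix(j,k)=0,\ (i,j,k)\in E\rangle .$$
   Context: $R^n$ is regarded as a left $R$-module. For $1\leq i\neq j\leq n$, $v(i,j)\in S$ is the vector whose $i$th entry is $-a_j$, whose $j$th entry is $a_i$, and whose other entries are $0$. $M$ is called normal if for each $p\in M$ the $n-1$ vectors $v(i,p)$, $i\neq p$, are $R$-linearly independent. $D$ is the set of pairs $(i,j)$ with $1\leq i<j\leq n$ and $\{i,j\}\cap M\neq\emptyset$. $E$ is the set of triples $(i,j,k)$ with $1\leq i<j<k\leq n$ and $|\{i,j,k\}\cap M|\geq 2$. $X$ is a free left $R$-module with basis $x(i,j)$, $(i,j)\in D$, and $\Lambda:X\to S$ is the $R$-module homomorphism with $\Lambda(x(i,j))=v(i,j)$ (it is surjective, since the $v(i,j)$ with $(i,j)\in D$ span $S$). $Y$ is the $R$-span in $X$ of the elements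 $y(i,j,k)=a_kx(i,j)-a_jx(i,k)+a_ix(j,k)$, $(i,j,k)\in E$ (so $Y=0$ if $E$ is empty). *)

(* Defs.v *)
From HB Require Import structures.
From mathcomp Require Import all_boot all_algebra.
From mathcomp Require Import boolp.

Set Implicit Arguments.
Unset Strict Implicit.
Unset Printing Implicit Defensive.

Import GRing.Theory.
Local Open Scope ring_scope.
Local Open Scope quotient_scope.

Definition central (R : nzRingType) (z : R) : Prop := forall x, z * x = x * z.

(* [\sum_(i in A) R a_i = R], as left ideals. *)
Definition generates (R : nzRingType) (n : nat) (a : 'I_n -> R) (A : {set 'I_n})
    : Prop :=
  forall r : R, exists c : 'I_n -> R, r = \sum_(i in A) c i * a i.

Definition lin_span (R : nzRingType) (V : lmodType R) (I : finType) (f : I -> V)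
    : {pred V} :=
  fun u => `[< exists c : I -> R, u = \sum_i c i *: f i >].

Section Presented.
Context {R : nzRingType} {V : lmodType R} {I : finType}.
Variable f : I -> V.

Lemma lin_spanP (u : V) :
  reflect (exists c : I -> R, u = \sum_i c i *: f i) (u \in lin_span f).
Proof. exact: asboolP. Qed.

Lemma lin_span_submod_closed : submod_closed (lin_span f).
Proof.
split=> [|k u w /lin_spanP[c ->] /lin_spanP[d ->]]; apply/lin_spanP.
  by exists (fun=> 0); rewrite big1 // => i _; rewrite scale0r.
exists (fun i => k * c i + d i); rewrite scaler_sumr -big_split /=.
by apply: eq_bigr => i _; rewrite scalerDl scalerA.
Qed.

HB.instance Definition _ :=
  GRing.isSubmodClosed.Build R V (lin_span f) lin_span_submod_closed.

(* The quotient left module [V / span f]; for [V] free on a basis this is the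
   module presented by that basis and the relators [f]. *)
Definition presented : Type := Quotient.quot (lin_span f).

HB.instance Definition _ := GRing.Zmodule.on presented.

Definition presented_pi (u : V) : presented := \pi_(Quotient.quot (lin_span f)) u.

Lemma presented_piP (u w : V) :
  reflect (presented_pi u = presented_pi w) (u - w \in lin_span f).
Proof. by rewrite Quotient.idealrBE; exact: eqP. Qed.

Lemma presented_piD : {morph presented_pi : u w / u + w}.
Proof. move=> u w; exact: (raddfD \pi_(Quotient.quot (lin_span f))). Qed.

Lemma presented_piK (q : presented) : presented_pi (repr q) = q.
Proof. exact: reprK. Qed.

Definition presented_scale (k : R) (q : presented) : presented :=
  presented_pi (k *: repr q).

Lemma presented_piZ k u : presented_pi (k *: u) = presented_scale k (presented_pi u).
Proof.
apply/presented_piP; rewrite -scalerBr rpredZ //.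
by apply/presented_piP; rewrite presented_piK.
Qed.

Fact presented_scaleA k l q :
  presented_scale k (presented_scale l q) = presented_scale (k * l) q.
Proof. by rewrite -[q]presented_piK -!presented_piZ scalerA. Qed.

Fact presented_scale1 : left_id 1 presented_scale.
Proof. by move=> q; rewrite -[q]presented_piK -presented_piZ scale1r. Qed.

Fact presented_scaleDr : right_distributive presented_scale +%R.
Proof.
move=> k q r; rewrite -[q]presented_piK -[r]presented_piK.
by rewrite -presented_piD -!presented_piZ scalerDr presented_piD.
Qed.

Fact presented_scaleDl q : {morph presented_scale^~ q : k l / k + l}.
Proof.
move=> k l /=; rewrite -[q]presented_piK.
by rewrite -!presented_piZ scalerDl presented_piD.
Qed.

HB.instance Definition _ := GRing.Zmodule_isLmodule.Build R presented
  presented_scaleA presented_scale1 presented_scaleDr presented_scaleDl.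

Fact presented_pi_linear : linear presented_pi.
Proof. by move=> k u w; rewrite presented_piD presented_piZ. Qed.

HB.instance Definition _ :=
  GRing.isLinear.Build R V presented *:%R presented_pi presented_pi_linear.

End Presented.

Section Relations.
Context {R : nzRingType} {n : nat}.
Implicit Types (a : 'I_n -> R) (M : {set 'I_n}).

(* The centrality proof is what makes [S] a left submodule of [R^n]. *)
Definition S_pred a (ca : forall i, central (a i)) : {pred 'rV[R]_n} :=
  fun x => \sum_i a i * x 0 i == 0.

Lemma S_submod_closed a (ca : forall i, central (a i)) :
  submod_closed (S_pred ca).
Proof.
split=> [|k u w]; rewrite !unfold_in.
  by rewrite big1 // => i _; rewrite mxE mulr0.
move=> /eqP u0 /eqP w0; apply/eqP.
transitivity (k * (\sum_i a i * u 0 i) + \sum_i a i * w 0 i).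
  rewrite mulr_sumr -big_split /=; apply: eq_bigr => i _.
  by rewrite !mxE mulrDr !mulrA ca.
by rewrite u0 w0 mulr0 addr0.
Qed.

HB.instance Definition _ a (ca : forall i, central (a i)) :=
  GRing.isSubmodClosed.Build R 'rV[R]_n (S_pred ca) (S_submod_closed ca).

Record S_mod a (ca : forall i, central (a i)) : Type :=
  SMod { S_val : 'rV[R]_n; S_valP : S_val \in S_pred ca }.

HB.instance Definition _ a (ca : forall i, central (a i)) :=
  [isSub for @S_val a ca].
HB.instance Definition _ a (ca : forall i, central (a i)) :=
  [Choice of S_mod ca by <:].
HB.instance Definition _ a (ca : forall i, central (a i)) :=
  [SubChoice_isSubLmodule of S_mod ca by <:].

(* Only meaningful for [i != j]. *)
Definition v a (i j : 'I_n) : 'rV[R]_n :=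
  \row_k (if k == i then - a j else if k == j then a i else 0).

Lemma v_in_S a (ca : forall i, central (a i)) (i j : 'I_n) :
  i != j -> v a i j \in S_pred ca.
Proof.
rewrite eq_sym => ji; rewrite unfold_in (bigD1 i) //= (bigD1 j) //= big1.
  by rewrite !mxE eqxx (negPf ji) eqxx mulrN ca addr0 addNr.
by move=> k /andP[/negPf ki /negPf kj]; rewrite mxE ki kj mulr0.
Qed.

Definition normal a M : Prop :=
  forall p, p \in M ->
  forall c : 'I_n -> R, \sum_(i | i != p) c i *: v a i p = 0 ->
  forall i, i != p -> c i = 0.

Definition D M : {set 'I_n * 'I_n} :=
  [set d : 'I_n * 'I_n | (d.1 < d.2)%N & [set d.1; d.2] :&: M != set0].

Definition E M : {set 'I_n * 'I_n * 'I_n} :=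
  [set t : 'I_n * 'I_n * 'I_n |
    [&& (t.1.1 < t.1.2)%N, (t.1.2 < t.2)%N
      & (2 <= #|[set t.1.1; t.1.2; t.2] :&: M|)%N]].

Definition D_idx M : Type := {d : 'I_n * 'I_n | d \in D M}.
Definition E_idx M : Type := {t : 'I_n * 'I_n * 'I_n | t \in E M}.
HB.instance Definition _ M := Finite.on (D_idx M).
HB.instance Definition _ M := Finite.on (E_idx M).

Definition X M : Type := {ffun D_idx M -> R^o}.
HB.instance Definition _ M := GRing.Lmodule.on (X M).

(* Junk value [0] when [(i, j)] is not in [D M]. *)
Definition x M (i j : 'I_n) : X M := [ffun d => ((val d == (i, j))%:R : R^o)].

Lemma D_neq M (d : D_idx M) : (val d).1 != (val d).2.
Proof.
by case: d => d /=; rewrite inE => /andP[lt _]; rewrite -val_eqE neq_ltn lt.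
Qed.

Definition v_S a (ca : forall i, central (a i)) M (d : D_idx M) : S_mod ca :=
  SMod (v_in_S ca (D_neq d)).

Definition Lambda a (ca : forall i, central (a i)) M (u : X M) : S_mod ca :=
  \sum_d (u d : R) *: v_S ca d.

Lemma Lambda_linear a (ca : forall i, central (a i)) M :
  linear (@Lambda a ca M).
Proof.
move=> k u w; rewrite /Lambda scaler_sumr -big_split /=.
by apply: eq_bigr => d _; rewrite !ffunE scalerDl scalerA.
Qed.

HB.instance Definition _ a (ca : forall i, central (a i)) M :=
  GRing.isLinear.Build R (X M) (S_mod ca) *:%R (@Lambda a ca M)
    (@Lambda_linear a ca M).

Lemma Lambda_x a (ca : forall i, central (a i)) M (d : D_idx M) :
  Lambda ca (x M (val d).1 (val d).2) = v_S ca d.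
Proof.
rewrite /Lambda (bigD1 d) //= ffunE -surjective_pairing eqxx scale1r big1.
  by rewrite addr0.
by move=> e ne; rewrite ffunE -surjective_pairing (inj_eq val_inj) (negPf ne) scale0r.
Qed.

Lemma X_basis M (u : X M) :
  u = \sum_d (u d : R) *: x M (val d).1 (val d).2.
Proof.
apply/ffunP => d; rewrite sum_ffunE (bigD1 d) //= !ffunE.
rewrite -surjective_pairing eqxx big1 ?addr0; first by rewrite /GRing.scale /= mulr1.
move=> e ne; rewrite !ffunE -surjective_pairing (inj_eq val_inj).
by rewrite eq_sym (negPf ne) scaler0.
Qed.

Definition y a M (t : E_idx M) : X M :=
  let: (i, j, k) := val t in a k *: x M i j - a j *: x M i k + a i *: x M j k.

(* So the junk value of [x] never occurs in [y]. *)
Lemma E_sub_D M (i j k : 'I_n) : (i, j, k) \in E M ->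
  [/\ (i, j) \in D M, (i, k) \in D M & (j, k) \in D M].
Proof.
rewrite inE /= => /and3P[ij jk c].
have key (p q r : 'I_n) : [set i; j; k] = [set p; q; r] ->
    [set p; q] :&: M != set0.
  move=> e; apply: contraL c => /eqP pq0; rewrite -ltnNge e setIUl pq0 set0U.
  by rewrite ltnS (leq_trans (subset_leq_card (subsetIl _ _))) // cards1.
rewrite !inE /= ij jk (ltn_trans ij jk) /=; split; last 1 first.
- by apply: (key _ _ i); apply/setP => z; rewrite !inE -orbA orbC.
- exact: (key _ _ k).
- by apply: (key _ _ j); apply/setP => z; rewrite !inE orbAC.
Qed.

Definition Y a M : {pred X M} := lin_span (@y a M).

End Relations.

Arguments presented_pi {R V I} f u.
Arguments y {R n} a M t.
Arguments Y {R n} a M.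

(* Main.v *)
From HB Require Import structures.
Require Import Defs.
From mathcomp Require Import all_boot all_algebra.
Import GRing.Theory.
Local Open Scope ring_scope.

(** Multiply everything by some [a_p] with [p] in [M]. Modulo [Y], the relator on
    [i], [j], [p] rewrites [a_p x(i,j)] as a combination of [x(i,p)] and
    [x(j,p)]; hence if [u] is in the kernel, [a_p u] is congruent to some
    [\sum_(i != p) c_i x(i,p)] whose image is zero, and normality forces [c = 0].
    So [a_p u] lies in [Y] for every [p] in [M], and as the [a_p] generate the
    unit ideal, so does [u]. The same localisation shows that [Lambda] is
    surjective, since [a_p s = - \sum_(i != p) s_i v(i,p)] for [s] in [S]. *)

Lemma lin_span_mem (R : nzRingType) (V : lmodType R) (I : finType) (f : I -> V)
    (i : I) : f i \in lin_span f.
Proof.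
apply/lin_spanP; exists (fun j => (j == i)%:R).
rewrite (bigD1 i) //= eqxx scale1r big1 ?addr0 // => j /negPf ->.
by rewrite scale0r.
Qed.

(** Write [1] as a left combination of the [a p] with [p] in [M] and let it act on [u]. *)
Lemma submod_local (R : nzRingType) (n : nat) (a : 'I_n -> R) (M : {set 'I_n})
    (V : lmodType R) (W : submodClosed V) (u : V) :
  generates a M -> (forall p, p \in M -> a p *: u \in W) -> u \in W.
Proof.
move=> hM hu; have [r one_r] := hM 1.
rewrite -[u]scale1r one_r scaler_suml rpred_sum // => p pM.
by rewrite -scalerA rpredZ ?hu.
Qed.

Section PresentedLift.
Context {R : nzRingType} {V W : lmodType R} {I : finType} {f : I -> V}.
Context {g : {linear V -> W}} (gf0 : forall i, g (f i) = 0).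

Lemma lin_span_ker (u : V) : u \in lin_span f -> g u = 0.
Proof.
move=> /lin_spanP[c ->]; rewrite linear_sum big1 // => i _.
by rewrite linearZ /= gf0 scaler0.
Qed.

(* The first argument is a phantom, so that the linear structure below can be
   inferred from the term. *)
Definition presented_lift of (forall i, g (f i) = 0) : presented f -> W :=
  fun q => g (repr q).

(** The representative chosen by [repr] differs from [u] by an element of the span, which [g]
    kills. *)
Lemma presented_liftE (u : V) : presented_lift gf0 (presented_pi f u) = g u.
Proof.
apply/eqP; rewrite -subr_eq0 -linearB; apply/eqP/lin_span_ker/presented_piP.
by rewrite presented_piK.
Qed.

Lemma presented_lift_linear : linear (presented_lift gf0).
Proof.
move=> k q r; rewrite -[q]presented_piK -[r]presented_piK -linearP.
by rewrite !presented_liftE linearP.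
Qed.

HB.instance Definition _ :=
  GRing.isLinear.Build R (presented f) W *:%R (presented_lift gf0) presented_lift_linear.

(** The inverse picks any preimage under [g]: two preimages differ by an element of the kernel, so
    their classes agree. *)
Lemma presented_lift_bij :
    (forall u, g u = 0 -> u \in lin_span f) -> (forall w, exists u, g u = w) ->
  bijective (presented_lift gf0).
Proof.
move=> ker_g surj_g.
have ex w : exists u, g u == w by have [u <-] := surj_g w; exists u.
have chK w : g (xchoose (ex w)) = w by exact/eqP/(xchooseP (ex w)).
exists (fun w => presented_pi f (xchoose (ex w))) => [q|w]; last first.
  by rewrite presented_liftE chK.
rewrite -[RHS]presented_piK; apply/presented_piP/ker_g.
by rewrite linearB chK subrr.
Qed.

End PresentedLift.

Section Relations.
Context {R : nzRingType} {n : nat} (a : 'I_n -> R) (ca : forall i, central (a i)).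
Context (M : {set 'I_n}).

Lemma scalerCA (V : lmodType R) (i : 'I_n) (k : R) (u : V) :
  a i *: (k *: u) = k *: (a i *: u).
Proof. by rewrite !scalerA ca. Qed.

(* Since [x M i j = 0] off [D M], this is the antisymmetric extension of
   [x(i,j)], [i < j]. *)
Definition xs (i j : 'I_n) : X (R := R) M := x M i j - x M j i.

Lemma xsN (i j : 'I_n) : xs j i = - xs i j.
Proof. by rewrite opprB. Qed.

Lemma xsii (i : 'I_n) : xs i i = 0.
Proof. exact: subrr. Qed.

Lemma x_out (i j : 'I_n) : (i, j) \notin D M -> x M i j = 0 :> X (R := R) M.
Proof.
move=> nD; apply/ffunP => d; rewrite !ffunE.
by case: eqP => // e; move: nD; rewrite -e (valP d).
Qed.

Lemma xs_lt (i j : 'I_n) : (i < j)%N -> xs i j = x M i j.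
Proof.
by move=> ij; rewrite /xs (x_out j i) ?subr0 // inE /= ltnNge (ltnW ij).
Qed.

Lemma xs_val (d : D_idx M) : xs (val d).1 (val d).2 = x M (val d).1 (val d).2.
Proof. by apply: xs_lt; case: d => d /=; rewrite inE => /andP[]. Qed.

Lemma mem_D (i j : 'I_n) : (i \in M) || (j \in M) -> ((i, j) \in D M) = (i < j)%N.
Proof.
move=> ijM; rewrite inE /=; case: ltnP => //= _.
by apply/set0Pn; case/orP: ijM => h; [exists i | exists j];
  rewrite !inE eqxx h ?orbT.
Qed.

Lemma vN (i j : 'I_n) : i != j -> v a j i = - v a i j.
Proof.
move=> ij; apply/rowP => k; rewrite !mxE.
by case: eqP => [->|_]; [rewrite eq_sym (negPf ij) | case: eqP; rewrite ?opprK ?oppr0].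
Qed.

Lemma val_Lambda_x (i j : 'I_n) : (i, j) \in D M ->
  val (Lambda ca (x M i j)) = v a i j.
Proof. by move=> ijD; rewrite (Lambda_x ca (Sub (i, j) ijD : D_idx M)). Qed.

(** An index in [M] is required: otherwise [xs i j] is [0], while [v a i j] need not be. *)
Lemma Lambda_xs (i j : 'I_n) : (i \in M) || (j \in M) -> i != j ->
  val (Lambda ca (xs i j)) = v a i j.
Proof.
wlog ij : i j / (i < j)%N => [hw ijM ne|ijM ne].
  case: (ltngtP i j) => [|ji|/val_inj e]; first by move/hw; apply.
    by rewrite xsN !linearN /= hw 1?orbC // 1?eq_sym // vN ?opprK // eq_sym.
  by rewrite e eqxx in ne.
have dD : (i, j) \in D M by rewrite mem_D.
by rewrite xs_lt // val_Lambda_x.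
Qed.

(** The alternating extension of the relators: on increasing triples of [E M] it is [y]. *)
Definition ys (i j k : 'I_n) : X M :=
  a k *: xs i j - a j *: xs i k + a i *: xs j k.

Lemma ys12 (i j k : 'I_n) : ys j i k = - ys i j k.
Proof. by rewrite /ys (xsN i j) scalerN !opprD opprK addrAC. Qed.

Lemma ys23 (i j k : 'I_n) : ys i k j = - ys i j k.
Proof.
by rewrite /ys (xsN j k) scalerN !opprD opprK; congr (_ - _); rewrite addrC.
Qed.

Lemma ysiik (i k : 'I_n) : ys i i k = 0.
Proof. by rewrite /ys xsii scaler0 sub0r addNr. Qed.

Lemma ys_lt_in_Y (i j k : 'I_n) : (i < j)%N -> (j < k)%N ->
  (1 < #|[set i; j; k] :&: M|)%N -> ys i j k \in Y a M.
Proof.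
move=> ij jk c; have tE : (i, j, k) \in E M by rewrite inE /= ij jk.
have := lin_span_mem _ _ _ (y a M) (Sub (i, j, k) tE).
by rewrite /y /= /ys !xs_lt // (ltn_trans ij).
Qed.

Lemma ys_in_Y (i j k : 'I_n) : (1 < #|[set i; j; k] :&: M|)%N -> ys i j k \in Y a M.
Proof.
(* Sort the three indices, using that [ys] is alternating. *)
have s12 p q r : [set p; q; r] = [set q; p; r] by rewrite (setUC [set p]).
have s23 p q r : [set p; q; r] = [set p; r; q] by rewrite setUAC.
wlog ij : i j k / (i <= j)%N => [hw|].
  by case/orP: (leq_total i j) => [/hw|h]; [exact | rewrite s12 ys12 rpredN; exact: hw].
wlog jk : i j k ij / (j <= k)%N => [hw c|].
  case/orP: (leq_total j k) => [h|kj]; first exact: hw.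
  rewrite ys23 rpredN; rewrite s23 in c.
  case/orP: (leq_total i k) => [ik|ki]; first exact: hw.
  by rewrite ys12 rpredN; apply: hw; rewrite // s12.
move=> c; case: (ltngtP i j) ij => // [ij|/val_inj->] _; last by rewrite ysiik rpred0.
case: (ltngtP j k) jk => // [jk|/val_inj->] _; first exact: ys_lt_in_Y.
by rewrite /ys xsii scaler0 addr0 subrr rpred0.
Qed.

(** If [p] is [i] or [j], alternation gives [0]; otherwise [p] and one of [i], [j] are two distinct
    elements of [M]. *)
Lemma ysp_in_Y (i j p : 'I_n) : p \in M -> (i \in M) || (j \in M) -> ys i j p \in Y a M.
Proof.
move=> pM ijM; have [<-|ip] := eqVneq i p.
  by rewrite ys23 ysiik oppr0 rpred0.
have [<-|jp] := eqVneq j p.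
  by rewrite ys12 ys23 ysiik !oppr0 rpred0.
apply: ys_in_Y; apply/card_gt1P.
by case/orP: ijM => h; [exists i, p | exists j, p]; split=> //;
  rewrite !inE eqxx ?orbT ?h ?pM.
Qed.

Lemma scale_mod_Y (p : 'I_n) (u : X M) : p \in M ->
  exists c : 'I_n -> R,
    a p *: u - \sum_(i | i != p) c i *: xs i p \in Y a M.
Proof.
move=> pM.
(* For [d = (i, j)], [w d] is what [a p *: xs i j] becomes when the relator [ys i j p] is set to
   [0]. *)
pose w (d : D_idx M) := a (val d).2 *: xs (val d).1 p - a (val d).1 *: xs (val d).2 p.
have /lin_spanP[c wc] : \sum_d (u d : R) *: w d \in lin_span (xs^~ p).
  rewrite rpred_sum // => d _; rewrite rpredZ // rpredB // rpredZ //.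
    exact: (lin_span_mem _ _ _ (xs^~ p)).
  exact: (lin_span_mem _ _ _ (xs^~ p)).
exists c; have -> : \sum_(i | i != p) c i *: xs i p = \sum_d (u d : R) *: w d.
  by rewrite wc [RHS](bigD1 p) //= xsii scaler0 add0r.
rewrite [X in a p *: X]X_basis scaler_sumr -sumrB rpred_sum // => d _.
rewrite -xs_val scalerCA -scalerBr rpredZ // opprB addrA addrAC.
apply: ysp_in_Y => //.
case: d => -[i j] /=; rewrite inE /= => /andP[_ /set0Pn[z]].
by rewrite !inE => /andP[/orP[] /eqP-> ->]; rewrite ?orbT.
Qed.

Lemma Lambda_y (t : E_idx M) : Lambda ca (y a M t) = 0.
Proof.
case: t => -[[i j] k] tE; rewrite /y /=.
have [ijD ikD jkD] := E_sub_D tE.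
have [ij jk] : (i < j)%N /\ (j < k)%N by move: tE; rewrite inE => /and3P[].
have [nij njk nik] : [/\ i != j, j != k & i != k].
  by rewrite -!val_eqE !neq_ltn ij jk (ltn_trans ij jk).
apply: val_inj; rewrite !linearD !linearN !linearZ /= !val_Lambda_x //.
(* At each of the coordinates [i], [j], [k], two products of entries of [a] cancel by centrality. *)
apply/rowP => l; rewrite !mxE.
have [->|_] := eqVneq l i.
  by rewrite (negPf nij) (negPf nik) mulr0 addr0 !mulrN opprK ca addNr.
have [->|_] := eqVneq l j.
  by rewrite (negPf njk) oppr0 mulr0 addr0 mulrN ca subrr.
have [_|_] := eqVneq l k; last by rewrite oppr0 !mulr0 !addr0.
by rewrite mulr0 add0r mulrN ca addNr.
Qed.

Lemma val_Lambda_sum (p : 'I_n) (c : 'I_n -> R) : p \in M ->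
  val (Lambda ca (\sum_(i | i != p) c i *: xs i p)) =
    \sum_(i | i != p) c i *: v a i p.
Proof.
move=> pM; rewrite [Lambda ca _]linear_sum [LHS]linear_sum.
by apply: eq_bigr => i ip; rewrite !linearZ /= Lambda_xs ?pM ?orbT.
Qed.

Lemma Lambda_ker (u : X M) : generates a M -> normal a M ->
  Lambda ca u = 0 -> u \in Y a M.
Proof.
move=> hM nrm u0; apply: (submod_local _ _ _ _ _ _ _ hM) => p pM.
have [c cY] := scale_mod_Y p u pM.
suff c0 : forall i, i != p -> c i = 0.
  by move: cY; rewrite big1 ?subr0 // => i ip; rewrite c0 ?scale0r.
apply: (nrm p pM); rewrite -val_Lambda_sum //.
(* [Lambda] kills both [Y] and [u], hence also the remaining combination of the [xs i p]. *)
have /eqP := lin_span_ker Lambda_y _ cY.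
by rewrite linearB linearZ /= u0 scaler0 sub0r oppr_eq0 => /eqP->.
Qed.

Lemma Lambda_surj (s : S_mod ca) : generates a M -> exists u : X M, Lambda ca u = s.
Proof.
move=> hM; have [r one_r] := hM 1.
(* The inner negated sum is a preimage of [a p *: s]; the weights [r p] glue these into a preimage
   of [s]. *)
exists (\sum_(p in M) r p *: - \sum_(i | i != p) (val s 0 i) *: xs i p).
rewrite -[RHS]scale1r one_r scaler_suml linear_sum; apply: eq_bigr => p pM.
rewrite linearZ -scalerA; congr (_ *: _); apply: val_inj.
rewrite linearN linearN linearZ /= val_Lambda_sum //.
apply/rowP => l; rewrite !mxE summxE; have [->|lp] := eqVneq l p.
  (* Coordinate [p] is the equation defining [S], solved for its [p]-th term. *)
  have /eqP := S_valP s; rewrite (bigD1 p) //= => /eqP; rewrite addr_eq0 => /eqP->.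
  by congr (- _); apply: eq_bigr => i ip; rewrite !mxE eq_sym (negPf ip) eqxx ca.
(* At any other coordinate [l], only the term [i = l] contributes. *)
rewrite (bigD1 l) //= big1 => [|i /andP[_ il]].
  by rewrite !mxE eqxx addr0 mulrN opprK ca.
by rewrite !mxE eq_sym (negPf il) (negPf lp) mulr0.
Qed.

End Relations.

Theorem theorem2p2 (R : nzRingType) (n : nat) (hn : (2 <= n)%N)
    (a : 'I_n -> R) (ca : forall i : 'I_n, central (a i))
    (ha : generates a [set: 'I_n])
    (M : {set 'I_n}) (hM : generates a M) (hnormal : normal a M) :
  (forall u : X M, Lambda ca u = 0 <-> u \in Y a M) /\
  (exists phi : {linear presented (y a M) -> S_mod ca},
     bijective phi /\
     forall d : D_idx M,
       phi (presented_pi (y a M) (x M (val d).1 (val d).2)) = v_S ca d).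
Proof.
have kerY u : Lambda ca u = 0 -> u \in Y a M by exact: Lambda_ker.
split=> [u|]; first by split=> [/kerY //|]; exact: (lin_span_ker (Lambda_y _ ca M)).
exists (presented_lift (Lambda_y _ ca M)); split=> [|d].
  by apply: presented_lift_bij => // s; exact: Lambda_surj.
by rewrite -Lambda_x; exact: presented_liftE.
Qed.
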